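(* For all integers $n,k\geqslant 1$, $$(-1)^k \bigg(\overline{p}(n)+2\sum_{j=1}^k (-1)^{j}\,\overline{p}(n-j^2) \bigg)\geqslant 0,$$ with strict inequality if $n\geqslant (k+1)^2$. For example, for all $n\geqslant 1$, $$\overline{p}(n)-2\overline{p}(n-1)\leqslant 0,$$ $$\overline{p}(n)-2\overline{p}(n-1)+2\overline{p}(n-4)\geqslant 0,$$ $$\overline{p}(n)-2\overline{p}(n-1)+2\overline{p}(n-4)-2\overline{p}(n-9)\leqslant 0.$$
   Context: The overpartition function $\overline{p}(n)$, for $n\geqslant 1$, denotes the number of ways of writing the integer $n$ as a sum of positive integers in non-increasing order in which the first occurrence of an integer may be overlined or not; $\overline{p}(0)=1$, and $\overline{p}(m)=0$ for all negative integers $m$. Equivalently, $\sum_{n=0}^{\infty}\overline{p}(n) q^n=\prod_{n=1}^\infty \frac{1+q^n}{1-q^n}=1+2q+4q^2+8q^3+14q^4+\cdots$. *)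

(* Defs.v *)
From HB Require Import structures.
From mathcomp Require Import all_boot all_order all_algebra.

Set Implicit Arguments.
Unset Strict Implicit.
Unset Printing Implicit Defensive.

Import Order.TTheory GRing.Theory Num.Theory.

(* A part is a pair (value, overlined?).  The last clause allows a part to be *)
(* overlined only at the first position at which its value occurs.            *)
Definition is_overpartition (n : nat) (s : seq (nat * bool)) : bool :=
  [&& all (fun x => 0 < x.1) s, sumn (unzip1 s) == n, sorted geq (unzip1 s)
    & [forall i : 'I_(size s),
        (nth (0, false) s i).2 ==>
          (index (nth (0, false) s i).1 (unzip1 s) == i)]].

(* An overpartition of n has at most n parts, each at most n, so all of them  *)
(* lie in this finite type: see overpartition_bounded.                        *)
Definition overpartition_candidate (n : nat) : finType :=
  n.-bseq ('I_n.+1 * bool)%type.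

Definition parts_of (n : nat) (s : overpartition_candidate n) :
    seq (nat * bool) :=
  [seq (val x.1, x.2) | x <- bseqval s].

Definition num_overpartitions (n : nat) : nat :=
  #|[set s : overpartition_candidate n | is_overpartition n (parts_of s)]|.

Lemma parts_of_inj (n : nat) : injective (@parts_of n).
Proof.
move=> s t est; apply: val_inj; apply: inj_map est.
by move=> [i a] [j b] [/val_inj -> ->].
Qed.

Lemma overpartition_bounded (n : nat) (s : seq (nat * bool)) :
  is_overpartition n s -> exists t : overpartition_candidate n, parts_of t = s.
Proof.
case/and4P=> pos /eqP sum_s _ _.
have size_s : size s <= n.
  rewrite -sum_s; elim: s pos {sum_s} => //= x s IHs /andP[x0 /IHs le_s].
  by rewrite -add1n leq_add.
have le_n x : x \in s -> x.1 <= n.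
  rewrite -sum_s; elim: s {pos sum_s size_s} => //= y s IHs.
  rewrite inE => /predU1P[-> | /IHs le_x]; first exact: leq_addr.
  exact: leq_trans le_x (leq_addl _ _).
have sz : size [seq ((inord x.1 : 'I_n.+1), x.2) | x <- s] <= n.
  by rewrite size_map.
exists (Bseq sz); rewrite /parts_of /= -map_comp -[RHS]map_id.
by apply/eq_in_map => -[m b] /le_n le_m /=; rewrite inordK.
Qed.

Definition overp (m : int) : int :=
  if m is Posz n then Posz (num_overpartitions n) else 0%R.

(* Main.v *)
(** Write p for the truncation at degree M of
      prod_i (1 + x^i) / (1 - x^i),
    whose coefficients count overpartitions.  The manifestly nonnegative series
      F_k = 2 prod_(i <= k) (1 + x^i)/(1 - x^i) * sum_(N > k)
              x^((k+1)N) / (1 - x^N) * prod_(i > N) (1 + x^i)/(1 - x^i)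
    satisfy F_0 = p - 1 and F_(k-1) + F_k = 2 x^(k^2) p, both by telescoping.
    By induction on k,
      (-1)^k (p * (1 + 2 sum_(1 <= j <= k) (-1)^j x^(j^2)) - 1) = F_k,
    and the summand N = k + 1 of F_k contributes to every exponent
    n >= (k+1)^2, because of the factor 1 / (1 - x).  The computation takes
    place in Z[x]/(x^(M+1)), where each 1 - x^i is invertible. *)
Require Import Defs.
From mathcomp Require Import all_boot all_order all_algebra.
From mathcomp Require Import ring zify.

Set Implicit Arguments.
Unset Strict Implicit.
Unset Printing Implicit Defensive.

Import Order.TTheory GRing.Theory Num.Theory.

(** * Overpartitions as sequences sorted by a local relation *)

(* In a non-increasing sequence, only first occurrences are overlined exactly
   when no part equal to its predecessor is overlined. *)
Definition ovrel (x y : nat * bool) : bool :=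
  (y.1 < x.1) || (y.1 == x.1) && ~~ y.2.

Definition weight (s : seq (nat * bool)) : nat := sumn (unzip1 s).

Lemma ovrel_trans : transitive ovrel.
Proof.
move=> [y b] [x a] [z c]; rewrite /ovrel /=.
case/orP=> [lt_yx | /andP[/eqP-> _]] //.
by case/orP=> [/ltn_trans-> //| /andP[/eqP-> _]]; rewrite lt_yx.
Qed.

Lemma index_nth_leq (T : eqType) (x0 : T) s i : index (nth x0 s i) s <= i.
Proof. by rewrite leqNgt; apply/negP => /(before_find x0) /=; rewrite eqxx. Qed.

(** An overlined part equal to its predecessor is not a first occurrence. Conversely, by
    transitivity of [ovrel], a part with an earlier equal one is related to it and so is not
    overlined. *)
Lemma is_overpartitionE (n : nat) (s : seq (nat * bool)) :
  is_overpartition n s =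
    [&& all (fun x => 0 < x.1) s, weight s == n & sorted ovrel s].
Proof.
rewrite /is_overpartition /weight; congr [&& _, _ & _].
pose x0 := (0, false).
have nth1 i : i < size s -> (nth x0 s i).1 = nth 0 (unzip1 s) i.
  by move=> lt_is; rewrite (nth_map x0).
apply/andP/idP => [[geq_s /forallP first_s] | ov_s].
  apply/(sortedP x0) => i lt_is.
  have lt_i := ltnW lt_is.
  have /(sortedP 0)/(_ i) := geq_s; rewrite size_map => /(_ lt_is).
  rewrite -!nth1 //= leq_eqVlt /ovrel => /orP[/eqP eq_i | ->] //.
  rewrite eq_i eqxx /=; apply/orP; right; apply/negP => b_i.
  have := first_s (Ordinal lt_is); rewrite /= b_i /= => /eqP.
  rewrite eq_i nth1 // => idx.
  by have := index_nth_leq 0 (unzip1 s) i; rewrite idx ltnn.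
split.
  rewrite sorted_map; apply: sub_sorted ov_s => x y.
  by rewrite /= => /orP[/ltnW | /andP[/eqP-> _]].
apply/forallP => i; apply/implyP => b_i.
have i_in : (nth x0 s i).1 \in unzip1 s by apply/map_f/mem_nth.
have le_idx : index (nth x0 s i).1 (unzip1 s) <= i.
  by rewrite nth1 // index_nth_leq.
rewrite eqn_leq le_idx leqNgt; apply/negP => lt_idx.
have := sorted_ltn_nth ovrel_trans x0 ov_s.
move=> /(_ (index (nth x0 s i).1 (unzip1 s)) i).
rewrite !inE ltn_ord (ltn_trans lt_idx) // => /(_ isT isT lt_idx).
rewrite /ovrel [(nth _ _ (index _ _)).1]nth1 ?(ltn_trans lt_idx) // nth_index //.
rewrite ltnn eqxx /=.
by rewrite b_i.
Qed.

(** * Enumeration of overpartitions by largest part *)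

(** The count [p.2] excludes the leading copy, so a block is never empty. *)
Definition ovblock (m : nat) (p : bool * nat) : seq (nat * bool) :=
  (m, p.1) :: nseq p.2 (m, false).

Definition ovheads (M : nat) : seq (bool * nat) :=
  [seq (b, j) | b <- [:: true; false], j <- iota 0 M].

(** Each part may independently have any multiplicity up to [M], so entries may weigh more than [M];
    this makes the generating polynomial an exact product. *)
Fixpoint overparts (M m : nat) : seq (seq (nat * bool)) :=
  if m is m'.+1 then
    overparts M m' ++
    [seq ovblock m p ++ t
       | p <- ovheads M, t <- overparts M m']
  else [:: [::]].

Lemma weight_cat (s t : seq (nat * bool)) :
  weight (s ++ t) = weight s + weight t.
Proof. by rewrite /weight /unzip1 map_cat sumn_cat. Qed.

Lemma weight_ovblock (m : nat) p : weight (ovblock m p) = p.2.+1 * m.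
Proof. by rewrite /weight /= /unzip1 map_nseq sumn_nseq mulSn mulnC. Qed.

Lemma overparts_sound (M m : nat) s : s \in overparts M m ->
  sorted ovrel s && all (fun x => 0 < x.1 <= m) s.
Proof.
elim: m s => [|m IHm] s /=; first by rewrite inE => /eqP->.
rewrite mem_cat => /orP[/IHm/andP[-> /allP le_s] |
  /allpairsP[[p t] /= [_ /IHm]]].
  by apply/allP => x /le_s /andP[-> /leqW].
case/andP=> ov_t le_t ->; rewrite /= leqnn /= all_cat all_nseq /= leqnn orbT /=.
have -> : all (fun x => 0 < x.1 <= m.+1) t.
  by apply: sub_all le_t => x /andP[-> /leqW].
rewrite andbT; elim: (p.2) (p.1) => [|j IHj] b /=.
  rewrite (path_sortedE ovrel_trans) ov_t andbT; apply: sub_all le_t => x.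
  by case/andP=> _; rewrite /ovrel ltnS => ->.
by rewrite IHj {1}/ovrel /= eqxx orbT.
Qed.

(** Copies of [m] after the head cannot be overlined, and the first smaller part bounds all later
    ones. *)
Lemma path_ovrel_split (m : nat) b s : path ovrel (m, b) s ->
  exists j t, [/\ s = nseq j (m, false) ++ t, sorted ovrel t
    & all (fun x => x.1 < m) t].
Proof.
elim: s b => [|[v c] s IHs] b /=; first by exists 0, [::].
case/andP=> /orP[lt_vm | /andP[/eqP /= -> /negbTE ->]] ov_s.
  exists 0, ((v, c) :: s); split=> //=; rewrite lt_vm.
  move: ov_s; rewrite (path_sortedE ovrel_trans) => /andP[le_s _].
  apply: sub_all le_s => x /orP[/ltn_trans-> // | /andP[/eqP-> _]] //.
by have [j [t [-> ? ?]]] := IHs _ ov_s; exists j.+1, t.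
Qed.

Lemma overparts_complete (M m : nat) s : weight s <= M ->
  sorted ovrel s -> all (fun x => 0 < x.1 <= m) s -> s \in overparts M m.
Proof.
elim: m s => [|m IHm] [|[v b] s] //=; first by case: v.
  by rewrite mem_cat IHm.
move=> wt_s ov_s /andP[/andP[v0 le_vm] le_s].
rewrite mem_cat; apply/orP; case: (ltnP m v) => [lt_mv | le_v]; last first.
  left; apply: IHm => //=; rewrite v0 le_v; apply/allP => x xs.
  have /andP[-> _] := allP le_s x xs.
  move: ov_s; rewrite (path_sortedE ovrel_trans) => /andP[/allP/(_ x xs) + _].
  by case/orP=> [/ltnW/leq_trans-> // | /andP[/eqP-> _]].
have {lt_mv le_vm} def_v : v = m.+1 by apply/eqP; rewrite eqn_leq le_vm.
rewrite {v}def_v in wt_s ov_s v0 *.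
have [j [t [def_s ov_t lt_t]]] := path_ovrel_split ov_s.
have wt : weight (ovblock m.+1 (b, j) ++ t) <= M by rewrite /= -def_s.
rewrite weight_cat weight_ovblock /= in wt.
right; apply/allpairsP; exists ((b, j), t); split; rewrite /= ?def_s //.
  apply/allpairsP; exists (b, j); split=> //=; first by case: (b).
  (* The [j.+1] copies of [m.+1] weigh at least [j.+1], hence [j < M]. *)
  rewrite mem_iota /= add0n; apply: leq_trans (leq_trans (leq_addr _ _) wt).
  by rewrite leq_pmulr.
apply: IHm => //; first exact: leq_trans (leq_addl _ _) wt.
apply/allP => x xt; have := allP lt_t x xt; rewrite ltnS => ->.
have /allP/(_ x) := le_s.
by rewrite def_s mem_cat xt orbT => /(_ isT)/andP[->].
Qed.

Lemma overparts_uniq (M m : nat) : uniq (overparts M m).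
Proof.
elim: m => //= m IHm; rewrite cat_uniq IHm /=; apply/andP; split.
  apply/hasPn => s /allpairsP[[p t] /= [_ _ ->]].
  apply/negP => /overparts_sound.
  by rewrite /= ltnn andbF.
apply: allpairs_uniq => //.
  by apply: allpairs_uniq => //; rewrite ?iota_uniq //
    => [[? ?] [? ?]] _ _ [-> ->].
(* The tail has no part [m.+1], so counting such parts recovers [j] and then the tail. *)
have count_t (t : seq (nat * bool)) :
    t \in overparts M m -> count (fun x => x.1 == m.+1) t = 0.
  case/overparts_sound/andP=> _ le_t; apply/eqP; rewrite eqn0Ngt -has_count.
  apply/hasPn => x /(allP le_t)/andP[_].
  by rewrite -ltnS ltn_neqAle => /andP[].
move=> [[b j] t] [[b' j'] t'] /allpairsP[[q r] /= [_ /count_t ct [_ ->]]].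
move=> /allpairsP[[q' r'] /= [_ /count_t ct' [_ ->]]] [-> eq_st].
have := congr1 (count (fun x => x.1 == m.+1)) eq_st.
rewrite !count_cat !count_nseq ct ct' eqxx /= !mul1n !addn0 => eq_j.
move/eqP: eq_st; rewrite eq_j eqseq_cat // => /andP[_ /eqP->].
by [].
Qed.

Lemma num_overpartitionsE (M n : nat) : n <= M ->
  num_overpartitions n = count (fun s => weight s == n) (overparts M M).
Proof.
move=> le_nM; rewrite /num_overpartitions cardE -(size_map (@parts_of n)).
rewrite -size_filter; apply/perm_size/uniq_perm.
- by rewrite map_inj_uniq ?enum_uniq //; apply: parts_of_inj.
- by rewrite filter_uniq ?overparts_uniq.
move=> s; rewrite mem_filter; apply/mapP/andP => [[t + ->] | [/eqP wt_s]].
  rewrite mem_enum inE is_overpartitionE => /and3P[pos /eqP wt ov].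
  rewrite wt; split=> //; apply: overparts_complete => //; first by rewrite wt.
  apply/allP => x xs; rewrite (allP pos) //= (leq_trans _ le_nM) // -wt.
  rewrite /weight; elim: (parts_of t) xs => //= y r IHr.
  rewrite inE => /predU1P[->|/IHr xr]; first exact: leq_addr.
  exact: leq_trans xr (leq_addl _ _).
case/overparts_sound/andP=> ov le_s.
have ov_s : is_overpartition n s.
  rewrite is_overpartitionE wt_s eqxx ov /= andbT.
  by apply: sub_all le_s => x /andP[].
have [t def_t] := overpartition_bounded ov_s.
by exists t => //; rewrite mem_enum inE def_t.
Qed.

Local Open Scope ring_scope.

(** * Telescoping identities in a commutative ring *)

Section Telescoping.

Variables (R : comNzRingType) (x : R) (u : nat -> R).

(* Products and sums are indexed from 0: the index [i] stands for the part
   size [i + 1], and [u i] for the inverse of [1 - x^(i + 1)]. *)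
Definition ovprod (m n : nat) : R := \prod_(m <= i < n) ((1 + x ^+ i.+1) * u i).

(** The series F_k with N = [i.+1], cut off at part size [M]. *)
Definition ovtail (M k : nat) : R :=
  2 * ovprod 0 k *
    \sum_(k <= i < M) x ^+ (k.+1 * i.+1) * u i * ovprod i.+1 M.

Hypothesis uP : forall i, u i * (1 - x ^+ i.+1) = 1.

Lemma ovprodS (m n : nat) : (m < n)%N ->
  ovprod m n = (1 + x ^+ m.+1) * u m * ovprod m.+1 n.
Proof. by move=> lt_mn; rewrite /ovprod big_ltn. Qed.

(** Puts [u i] into a term lacking it, so that [ring] can compare both terms of a difference. *)
Lemma ovprod_geo (i M : nat) :
  ovprod i.+1 M = u i * (1 - x ^+ i.+1) * ovprod i.+1 M.
Proof. by rewrite uP mul1r. Qed.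

(** With y = x^(i+1), the telescoping rests on (1 + y) - (1 - y) = 2 y. *)
Lemma ovtail0 (M : nat) : ovtail M 0 = ovprod 0 M - 1.
Proof.
have -> : ovprod 0 M - 1 = \sum_(0 <= i < M) (ovprod i M - ovprod i.+1 M).
  rewrite (telescope_sumr_eq (fun i => - ovprod i M)) //.
    by rewrite /ovprod [in RHS]big_geq //; ring.
  by move=> i _; ring.
rewrite /ovtail {1}/ovprod big_geq // mulr1 mulr_sumr.
apply: eq_big_nat => i /andP[_ lt_iM].
rewrite (ovprodS lt_iM) [X in _ - X]ovprod_geo mul1n; ring.
Qed.

Lemma ovtail_add (M k : nat) : (k < M)%N -> x ^+ M.+1 = 0 ->
  ovtail M k + ovtail M k.+1 = 2 * x ^+ (k.+1 ^ 2) * ovprod 0 M.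
Proof.
move=> lt_kM xM0.
have ovprod_split : ovprod 0 M = ovprod 0 k * ovprod k M.
  by rewrite /ovprod (@big_cat_nat _ _ _ k) ?(ltnW lt_kM).
(* With y = x^(i+1) and z = x^(k+1), the summands telescope because (1 - z) + (1 + z) y = (1 + y) -
   z (1 - y). *)
have telescope :
    (1 - x ^+ k.+1) *
      (\sum_(k.+1 <= i < M) x ^+ (k.+1 * i.+1) * u i * ovprod i.+1 M) +
    (1 + x ^+ k.+1) *
      (\sum_(k.+1 <= i < M) x ^+ (k.+2 * i.+1) * u i * ovprod i.+1 M)
    = x ^+ k.+1 * (x ^+ (k.+1 * k.+1) * ovprod k.+1 M).
  rewrite !mulr_sumr -big_split /=.
  rewrite (telescope_sumr_eq (fun i => - (x ^+ (k.+1 * i.+1) * ovprod i M))) //.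
    have -> : x ^+ (k.+1 * M.+1) = 0 by rewrite mulnC exprM xM0 expr0n.
    by rewrite mulnS exprD; ring.
  move=> i /andP[_ lt_iM].
  rewrite (ovprodS lt_iM) [X in - (_ * X) - _]ovprod_geo.
  rewrite !mulnS !mulSn !exprD !exprS; ring.
rewrite /ovtail (big_ltn lt_kM) ovprod_split (ovprodS lt_kM).
have -> : ovprod 0 k.+1 = ovprod 0 k * ((1 + x ^+ k.+1) * u k).
  by rewrite /ovprod big_nat_recr.
set S1 := \sum_(_ <= i < _) _ in telescope *.
set S2 := \sum_(_ <= i < _) _ in telescope *.
set t := x ^+ (k.+1 * k.+1) in telescope *.
(* The term [ovtail x u M k] lacks the common factor [u k]; it is inserted together with 1 -
   x^(k+1), the coefficient of [S1] in [telescope]. *)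
rewrite -[2 * ovprod 0 k]mulr1 -{1}(uP k).
transitivity (2 * ovprod 0 k * u k *
    (((1 - x ^+ k.+1) * S1 + (1 + x ^+ k.+1) * S2)
     + t * ((u k * (1 - x ^+ k.+1)) * ovprod k.+1 M))); first ring.
by rewrite telescope uP mul1r; ring.
Qed.

Lemma truncated_theta (M k : nat) : (k <= M)%N -> x ^+ M.+1 = 0 ->
  (-1) ^+ k *
    (ovprod 0 M * (1 + 2 * \sum_(1 <= j < k.+1) (-1) ^+ j * x ^+ (j ^ 2)) - 1)
  = ovtail M k.
Proof.
move=> le_kM xM0; elim: k le_kM => [|k IHk] le_kM.
  by rewrite big_geq // ovtail0; ring.
have := ovtail_add le_kM xM0; rewrite -IHk ?(ltnW le_kM) //.
move=> /(canRL (addKr _)) ->.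
have sgnK : (-1) ^+ k * (-1) ^+ k = 1 :> R.
  by rewrite -exprMn mulrNN mulr1 expr1n.
rewrite big_nat_recr //= exprS.
set S := \sum_(_ <= j < _) _.
transitivity (- ((-1) ^+ k * (ovprod 0 M * (1 + 2 * S) - 1))
  + (-1) ^+ k * (-1) ^+ k * (2 * x ^+ (k.+1 ^ 2) * ovprod 0 M)).
  by ring.
by rewrite sgnK mul1r.
Qed.

End Telescoping.

(** * Passage to polynomials modulo X^(M+1) *)

Lemma rmorph_ovprod (R S : comNzRingType) (f : {rmorphism R -> S}) x u m n :
  f (ovprod x u m n) = ovprod (f x) (f \o u) m n.
Proof.
rewrite /ovprod rmorph_prod; apply: eq_bigr => i _ /=.
by rewrite rmorphM rmorphD rmorph1 rmorphXn.
Qed.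

Lemma rmorph_ovtail (R S : comNzRingType) (f : {rmorphism R -> S}) x u M k :
  f (ovtail x u M k) = ovtail (f x) (f \o u) M k.
Proof.
rewrite /ovtail !rmorphM rmorph_nat rmorph_ovprod rmorph_sum; congr (_ * _).
by apply: eq_bigr => i _; rewrite !rmorphM rmorphXn rmorph_ovprod.
Qed.

Lemma coef_in_qpolyXn (R : nzRingType) (M i : nat) (p : {poly R}) :
  (i <= M)%N -> (in_qpoly 'X^(M.+1) p)`_i = p`_i.
Proof.
move=> le_iM; rewrite /= mk_monic_Xn /=.
rewrite [in RHS](Pdiv.RingMonic.rdivp_eq (monicXn R M.+1) p).
by rewrite coefD coefMXn ltnS le_iM add0r.
Qed.

Lemma in_qpolyX_exp (R : comNzRingType) (M : nat) :
  in_qpoly ('X^(M.+1) : {poly R}) 'X ^+ M.+1 = 0.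
Proof.
rewrite -rmorphXn; apply: val_inj => /=.
by rewrite mk_monic_Xn Pdiv.RingMonic.rmodpp ?monicXn.
Qed.

(** A polynomial with nonnegative coefficients that inverts 1 - X^(i+1) modulo X^(M+1). *)
Definition geo (M i : nat) : {poly int} := \sum_(j < M.+1) 'X^(i.+1 * j).

Lemma geo_mul1B (M i : nat) : geo M i * (1 - 'X^(i.+1)) = 1 - 'X^(i.+1 * M.+1).
Proof.
have := subrX1 ('X^(i.+1) : {poly int}) M.+1; rewrite -exprM => def_X.
rewrite -[RHS]opprB def_X -mulNr opprB mulrC; congr (_ * _).
by apply: eq_bigr => j _; rewrite exprM.
Qed.

Lemma in_qpoly_geo (M i : nat) (h := 'X^(M.+1) : {poly int}) :
  in_qpoly h (geo M i) * (1 - in_qpoly h 'X ^+ i.+1) = 1.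
Proof.
have := congr1 (in_qpoly h) (geo_mul1B M i).
rewrite rmorphM !rmorphB rmorph1 !rmorphXn.
by move=> ->; rewrite mulnC exprM in_qpolyX_exp expr0n subr0.
Qed.

(** A part size is absent, or present 1 to [M] times with its first copy overlined or not: 1 + 2
    ([geo M i] - 1). *)
Lemma overparts_gen (M m : nat) :
  \sum_(s <- overparts M m) 'X^(weight s)
  = \prod_(0 <= i < m) (2 * geo M i - 1) :> {poly int}.
Proof.
elim: m => [|m IHm]; first by rewrite big_geq //= big_seq1.
rewrite big_nat_recr //= -IHm big_cat big_allpairs_dep /=.
set G := \sum_(s <- _) _.
have -> : \sum_(p <- ovheads M) \sum_(t <- overparts M m)
    'X^(weight (ovblock m.+1 p ++ t))
    = \sum_(p <- ovheads M) 'X^(m.+1 * p.2.+1) * G.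
  apply: eq_bigr => p _; rewrite mulr_sumr; apply: eq_bigr => t _.
  by rewrite weight_cat weight_ovblock exprD mulnC.
rewrite -mulr_suml big_allpairs big_cons big_seq1 /=.
have -> : geo M m = 1 + \sum_(j <- iota 0 M) 'X^(m.+1 * j.+1).
  rewrite /geo big_ord_recl muln0 expr0; congr (_ + _).
  by rewrite -[M in iota _ M]subn0 -/(index_iota 0 M) big_mkord.
ring.
Qed.

Lemma coef_overparts_gen (M n : nat) : (n <= M)%N ->
  (\sum_(s <- overparts M M) 'X^(weight s) : {poly int})`_n = overp n.
Proof.
move=> le_nM; rewrite /= (num_overpartitionsE le_nM) coef_sum.
rewrite -sum1_count (big_mkcond (fun s => weight s == n)) /=.
rewrite -[RHS]natz natr_sum.
by apply: eq_bigr => s _; rewrite coefXn eq_sym; case: eqP.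
Qed.

(** The two polynomials agree modulo X^(M+1), which determines the coefficients up to [M]. *)
Lemma overparts_gen_theta (M k n : nat)
    (P : {poly int} := \sum_(s <- overparts M M) 'X^(weight s)) :
  (k <= M)%N -> (n <= M)%N ->
  ((-1) ^+ k *
    (P * (1 + 2 * \sum_(1 <= j < k.+1) (-1) ^+ j * 'X^(j ^ 2)) - 1))`_n
  = (ovtail 'X (geo M) M k)`_n.
Proof.
move=> le_kM le_nM.
rewrite -[LHS](coef_in_qpolyXn _ le_nM) -[RHS](coef_in_qpolyXn _ le_nM).
congr (_`_n).
congr (polyn _); set h := 'X^(M.+1).
have uP i : (in_qpoly h \o geo M) i * (1 - in_qpoly h 'X ^+ i.+1) = 1.
  exact: in_qpoly_geo.
rewrite rmorph_ovtail -(truncated_theta uP le_kM (in_qpolyX_exp _ M)).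
rewrite rmorphM rmorphXn rmorphN1 rmorphB rmorphM rmorph1.
rewrite rmorphD rmorphM rmorph1 rmorph_nat.
congr (_ * (_ * (1 + 2 * _) - 1)).
  rewrite /P overparts_gen rmorph_prod; apply: eq_bigr => i _.
  (* With u the inverse of 1 - y, 2 u - 1 = 2 u - u (1 - y) = (1 + y) u. *)
  rewrite rmorphB rmorphM rmorph_nat rmorph1 -[X in _ - X](uP i) /=; ring.
rewrite rmorph_sum; apply: eq_bigr => j _.
by rewrite rmorphM !rmorphXn rmorphN1.
Qed.

(** * Nonnegativity and positivity of coefficients *)

Lemma coef_nneg (p : {poly int}) (i : nat) :
  p \is a polyOver Num.Def.nneg_num_pred -> 0 <= p`_i.
Proof. by move/polyOverP/(_ i). Qed.

Lemma geo_nneg (M i : nat) : geo M i \is a polyOver Num.Def.nneg_num_pred.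
Proof. by rewrite /geo; apply: rpred_sum => j _; rewrite rpredX ?polyOverX. Qed.

Lemma ovprod_nneg (M m n : nat) :
  ovprod 'X (geo M) m n \is a polyOver Num.Def.nneg_num_pred.
Proof.
rewrite /ovprod; apply: rpred_prod => i _.
by rewrite rpredM ?geo_nneg ?rpredD ?rpred1 ?rpredX ?polyOverX.
Qed.

Lemma ovtail_summand_nneg (M e i : nat) :
  'X^e * geo M i * ovprod 'X (geo M) i.+1 M \is a polyOver Num.Def.nneg_num_pred.
Proof. by rewrite !rpredM ?ovprod_nneg ?geo_nneg ?rpredX ?polyOverX. Qed.

Lemma ovtail_nneg (M k : nat) :
  ovtail 'X (geo M) M k \is a polyOver Num.Def.nneg_num_pred.
Proof.
rewrite /ovtail rpredM ?rpred_sum // => [|i _]; last exact: ovtail_summand_nneg.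
by rewrite rpredM ?ovprod_nneg ?rpred_nat.
Qed.

Lemma coef0_geo (M i : nat) : (geo M i)`_0 = 1.
Proof.
rewrite -horner_coef0 horner_sum big_ord_recl muln0 expr0 hornerC.
rewrite big1 ?addr0 //.
by move=> j _; rewrite hornerXn mulSn expr0n.
Qed.

Lemma coef0_ovprod (M m n : nat) : (ovprod 'X (geo M) m n)`_0 = 1.
Proof.
rewrite -horner_coef0 horner_prod big1 // => i _.
rewrite hornerM hornerD hornerC hornerXn expr0n addr0.
by rewrite horner_coef0 coef0_geo mulr1.
Qed.

(** The coefficients of [geo M 0] up to degree [M] are 1, so the constant term of [q] alone makes
    the convolution positive. *)
Lemma coefM_geo0_gt0 (M n : nat) (q : {poly int}) : (n <= M)%N ->
  q \is a polyOver Num.Def.nneg_num_pred -> 0 < q`_0 -> 0 < (geo M 0 * q)`_n.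
Proof.
move=> le_nM q_ge0 q0; rewrite coefM big_ord_recr /= subnn.
apply: ltr_wpDl.
  by apply: sumr_ge0 => i _; rewrite mulr_ge0 ?coef_nneg ?geo_nneg.
apply: mulr_gt0 q0.
rewrite coef_sum (bigD1 (Ordinal (le_nM : (n < M.+1)%N))) //=.
rewrite mul1n coefXn eqxx ltr_wpDr // sumr_ge0 // => j _.
by rewrite coefXn ler0n.
Qed.

Lemma ovtail_gt0 (M k n : nat) : (0 < k)%N -> (k < M)%N ->
  (k.+1 ^ 2 <= n <= M)%N -> 0 < (ovtail 'X (geo M) M k)`_n.
Proof.
move=> k_gt0 lt_kM /andP[le_kn le_nM].
rewrite /ovtail (big_ltn lt_kM) mulrDr coefD; apply: ltr_wpDr.
  apply: coef_nneg.
  rewrite rpredM ?rpred_sum // => [|i _]; last exact: ovtail_summand_nneg.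
  by rewrite rpredM ?ovprod_nneg ?rpred_nat.
(* As [0 < k], the prefix product contains part size 1, whose factor supplies [geo M 0]; the
   cofactor [q] below has constant term 2. *)
rewrite (ovprodS _ _ k_gt0).
pose q := 2 * ((1 + 'X^1) * ovprod 'X (geo M) 1 k * geo M k *
  ovprod 'X (geo M) k.+1 M).
have -> : 2 * ((1 + 'X^1) * geo M 0 * ovprod 'X (geo M) 1 k) *
  ('X^(k.+1 * k.+1) * geo M k * ovprod 'X (geo M) k.+1 M)
  = geo M 0 * q * 'X^(k.+1 ^ 2) by rewrite /q -mulnn; ring.
rewrite coefMXn ltnNge le_kn /=; apply: coefM_geo0_gt0.
- exact: leq_trans (leq_subr _ _) le_nM.
- by rewrite !(rpredM, rpredD, rpredX, rpred1, rpred_nat)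
       ?ovprod_nneg ?geo_nneg ?polyOverX.
- by rewrite /q -polyC_natr coefCM !coef0M coefD coef1 coefXn
       !coef0_ovprod coef0_geo.
Qed.

(** * Return to overpartition numbers *)

(** Multiplying by X^(j^2) shifts the argument of [overp], and the term -1 affects only degree 0,
    excluded by [0 < n]. *)
Lemma overp_truncated_sum (M k n : nat) : (0 < n <= M)%N -> (k <= M)%N ->
  (-1) ^+ k * (overp n%:Z
      + 2 * \sum_(1 <= j < k.+1) (-1) ^+ j * overp (n%:Z - j%:Z ^+ 2))
  = (ovtail 'X (geo M) M k)`_n.
Proof.
case/andP=> n_gt0 le_nM le_kM; rewrite -overparts_gen_theta //.
set P := \sum_(s <- overparts M M) _.
have coefP j : (P * ((-1) ^+ j * 'X^(j ^ 2)))`_n =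
    (-1) ^+ j * overp (n%:Z - j%:Z ^+ 2).
  rewrite mulrCA -signr_odd -[in RHS]signr_odd !mulr_sign.
  have -> : overp (n%:Z - j%:Z ^+ 2) = (P * 'X^(j ^ 2))`_n.
    rewrite coefMXn -[j%:Z ^+ 2]/(Posz (j * j)) -mulnn.
    case: ltnP => [lt_n|le_n].
      (* The argument is minus a natural number; that number must be a successor for [overp] to
         reduce to 0. *)
      rewrite -opprB subzn 1?ltnW //; move: lt_n; rewrite -subn_gt0.
      by case: (_ - _)%N.
    by rewrite subzn // coef_overparts_gen // (leq_trans (leq_subr _ _)).
  by case: odd; rewrite ?coefN.
have -> : (-1) ^+ k *
    (P * (1 + 2 * \sum_(1 <= j < k.+1) (-1) ^+ j * 'X^(j ^ 2)) - 1)
  = ((-1) ^+ k)%:P *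
    (P + 2%:P * \sum_(1 <= j < k.+1) P * ((-1) ^+ j * 'X^(j ^ 2)) - 1).
  by rewrite -mulr_sumr polyC_exp polyCN polyC_natr polyC1; ring.
rewrite coefCM coefB coefD coefCM coef1 (gtn_eqF n_gt0) subr0.
rewrite coef_overparts_gen // coef_sum; congr (_ * (_ + _ * _)).
by apply: eq_bigr => j _; rewrite coefP.
Qed.

Theorem corollary1p2 (n : nat) (hn : (1 <= n)%N) :
  (forall k : nat, (1 <= k)%N ->
    let T := (-1) ^+ k * (overp n%:Z
      + 2 * \sum_(1 <= j < k.+1) (-1) ^+ j * overp (n%:Z - j%:Z ^+ 2)) in
    0 <= T /\ ((k.+1 ^ 2 <= n)%N -> 0 < T))
  /\ overp n%:Z - 2 * overp (n%:Z - 1) <= 0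
  /\ 0 <= overp n%:Z - 2 * overp (n%:Z - 1) + 2 * overp (n%:Z - 4)
  /\ overp n%:Z - 2 * overp (n%:Z - 1) + 2 * overp (n%:Z - 4)
       - 2 * overp (n%:Z - 9) <= 0.
Proof.
have T_ge0 (k : nat) : 0 <= (-1) ^+ k * (overp n%:Z
    + 2 * \sum_(1 <= j < k.+1) (-1) ^+ j * overp (n%:Z - j%:Z ^+ 2)).
  (* The degree [n + k] bounds both [n] and [k]; since [1 <= n] it exceeds [k], as strictness
     requires below. *)
  rewrite (@overp_truncated_sum (n + k)) ?hn ?leq_addr ?leq_addl //.
  exact/coef_nneg/ovtail_nneg.
split=> [k k_gt0 T|].
  split=> [|le_kn]; first exact: T_ge0.
  rewrite /T (@overp_truncated_sum (n + k)) ?hn ?leq_addr ?leq_addl //.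
  by apply: ovtail_gt0; rewrite // ?le_kn ?leq_addr // -[k.+1]add1n leq_add2r.
have := T_ge0 1%N; have := T_ge0 2%N; have := T_ge0 3%N.
rewrite unlock /= -[1 ^+ 2]/(1 : int) -[2%:Z ^+ 2]/(4 : int).
rewrite -[3%:Z ^+ 2]/(9 : int).
set a := overp n; set b := overp (n%:Z - 1).
set c := overp (n%:Z - 4); set d := overp (n%:Z - 9).
by move=> h3 h2 h1; split; [|split]; lia.
Qed.
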